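(* Let $n\ge1$, $0<s<1$, $p>1$, $\lambda\in\mathbb{R}$, $\Sigma_\lambda=\{x\in\mathbb{R}^n: x_1<\lambda\}$, and for $x\in\mathbb{R}^n$ let $x^\lambda=(2\lambda-x_1,x_2,\dots,x_n)$. Let $u:\mathbb{R}^n\to\mathbb{R}$, set $u_\lambda(x)=u(x^\lambda)$ and $w(x)=u_\lambda(x)-u(x)$. Let $\Omega$ be a bounded domain contained in $\Sigma_\lambda$. Assume $w\in L_{sp}\cap C^{1,1}_{loc}(\Omega)$, $w$ is lower semi-continuous on $\bar\Omega$, $(-\Delta)^s_p u$ and $(-\Delta)^s_p u_\lambda$ are defined at every point of $\Omega$, and $$(-\Delta)^s_p u_\lambda(x)-(-\Delta)^s_p u(x)\ge 0 \text{ in }\Omega,\qquad w(x)\ge 0 \text{ in }\Sigma_\lambda\setminus\Omega,\qquad w(x^\lambda)=-w(x)\text{ in }\Sigma_\lambda.$$ Then $w(x)\ge 0$ in $\Omega$. Furthermore, if $w=0$ at some point of $\Omega$, then $w=0$ almost everywhere in $\mathbb{R}^n$. These conclusions also hold for an unbounded region $\Omega\subset\Sigma_\lambda$ if one additionally assumes $\liminf_{|x|\to\infty} w(x)\ge 0$.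
   Context: The fractional $p$-Laplacian is $$(-\Delta)^s_p u(x)=C_{n,sp}\,\lim_{\epsilon\to 0}\int_{\mathbb{R}^n\setminus B_\epsilon(x)}\frac{|u(x)-u(y)|^{p-2}[u(x)-u(y)]}{|x-y|^{n+sp}}\,dy,$$ with $C_{n,sp}>0$ a normalizing constant, and $$L_{sp}=\Big\{u\in L^1_{loc}(\mathbb{R}^n)\ :\ \int_{\mathbb{R}^n}\frac{|u(x)|}{1+|x|^{n+sp}}\,dx<\infty\Big\}.$$ *)

(* Defs.v *)
From HB Require Import structures.
From mathcomp Require Import all_boot all_order all_algebra.
From mathcomp Require Import all_classical all_reals all_analysis.
Set Implicit Arguments. Unset Strict Implicit. Unset Printing Implicit Defensive.
Import Order.TTheory GRing.Theory Num.Theory.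
Import numFieldNormedType.Exports.
Local Open Scope classical_set_scope.
Local Open Scope ring_scope.

Section sf_pack.
Context d (T : measurableType d) (R : realType).
Variables (m : {measure set T -> \bar R}) (H : sigma_finite setT m).
Definition sfm : set T -> \bar R := m.
HB.instance Definition _ := Measure.on sfm.
HB.instance Definition _ := Measure_isSigmaFinite.Build _ _ _ sfm H.
Definition sf_pack : {sigma_finite_measure set T -> \bar R} := sfm.
End sf_pack.

Section prod_sf.
Local Open Scope ereal_scope.
Context d1 d2 (T1 : measurableType d1) (T2 : measurableType d2) (R : realType).
Variable m1 : {sigma_finite_measure set T1 -> \bar R}.
Variable m2 : {sigma_finite_measure set T2 -> \bar R}.

Lemma prod_sigma_finite : sigma_finite setT (m1 \x m2).
Proof.
have /sigma_finiteP[F [TF ndF Foo]] := sigma_finiteT m1.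
have /sigma_finiteP[G [TG ndG Goo]] := sigma_finiteT m2.
exists (fun n => F n `*` G n).
 rewrite -setXTT TF TG predeqE => -[x y]; split.
    move=> [/= [n _ Fnx] [k _ Gky]]; exists (maxn n k) => //; split.
    - by move: x Fnx; exact/subsetPset/ndF/leq_maxl.
    - by move: y Gky; exact/subsetPset/ndG/leq_maxr.
  by move=> [n _ []/= ? ?]; split; exists n.
move=> k; have [? ?] := Foo k; have [? ?] := Goo k.
split; first exact: measurableX.
by rewrite product_measure1E// lte_mul_pinfty// ge0_fin_numE.
Qed.

Definition prod_sf : {sigma_finite_measure set (T1 * T2)%type -> \bar R} :=
  sf_pack prod_sigma_finite.
End prod_sf.

(* n-dimensional Lebesgue (Borel product) measure, built as the        *)
(* iterated product  lebesgue_measure \x (... \x (dirac tt))  on the    *)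
(* nested type  R * (R * ( ... * unit)), together with the canonical    *)
(* bijection of that type onto the row vectors 'rV[R]_n.               *)
Record mspace (R : realType) (n : nat) := MSpace {
  ms_disp : measure_display ;
  ms_car : measurableType ms_disp ;
  ms_mu : {sigma_finite_measure set ms_car -> \bar R} ;
  ms_vec : ms_car -> 'rV[R]_n }.

Fixpoint lebn_space (R : realType) (n : nat) : mspace R n :=
  match n with
  | 0 => @MSpace R 0 _ unit
           (@dirac _ unit tt R : {sigma_finite_measure set unit -> \bar R})
           (fun _ => 0)
  | k.+1 =>
    let S := lebn_space R k in
    @MSpace R k.+1 _ _ (prod_sf (@lebesgue_measure R) (ms_mu S))
      (fun y => row_mx (\row_(j < 1) y.1) (@ms_vec _ _ S y.2))
  end.

(* Euclidean norm |x| (the library norm on 'rV is the sup norm). *)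
Definition eucl_norm (R : realType) (n : nat) (x : 'rV[R]_n) : R :=
  Num.sqrt (\sum_(i < n) x 0 i ^+ 2).

Definition refl (R : realType) (n : nat) (lam : R) (x : 'rV[R]_n) : 'rV[R]_n :=
  \row_(i < n) (if (i : nat) == 0%N then 2 * lam - x 0 i else x 0 i).

Definition Sigma (R : realType) (n : nat) (lam : R) : set 'rV[R]_n.+1 :=
  [set x | x 0 ord0 < lam].

Definition is_domain (R : realType) (n : nat) (Om : set 'rV[R]_n) : Prop :=
  [/\ open Om, connected Om & Om !=set0].

Definition lsc_on (R : realType) (n : nat) (A : set 'rV[R]_n) (w : 'rV[R]_n -> R) :=
  forall x, A x -> forall e : R, 0 < e -> \forall y \near x, A y -> w x - e < w y.

Definition C11_loc (R : realType) (n : nat) (Om : set 'rV[R]_n) (w : 'rV[R]_n -> R) :=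
  (forall x, Om x -> differentiable w x) /\
  (forall K, compact K -> K `<=` Om -> exists L : R, forall x y, K x -> K y ->
     forall i : 'I_n,
       `|'D_(delta_mx 0 i) w x - 'D_(delta_mx 0 i) w y| <= L * eucl_norm (x - y)).

Definition lebn_car (R : realType) (n : nat) := ms_car (lebn_space R n).
Definition lebn (R : realType) (n : nat) := ms_mu (lebn_space R n).
Definition vecn (R : realType) (n : nat) : lebn_car R n -> 'rV[R]_n :=
  @ms_vec R n (lebn_space R n).
Arguments lebn_car : clear implicits.
Arguments lebn : clear implicits.
Arguments vecn : clear implicits.

Definition leb_null (R : realType) (n : nat) (A : set 'rV[R]_n) : Prop :=
  exists B : set (lebn_car R n),
    [/\ measurable B, lebn R n B = 0%E & vecn R n @^-1` A `<=` B].

Definition borel_integrable (R : realType) (n : nat) (D : set 'rV[R]_n)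
    (g : 'rV[R]_n -> R) : Prop :=
  (lebn R n).-integrable (vecn R n @^-1` D) (fun y => (g (vecn R n y))%:E).

Definition leb_integral_is (R : realType) (n : nat) (D : set 'rV[R]_n)
    (f : 'rV[R]_n -> R) (v : R) : Prop :=
  exists g : 'rV[R]_n -> R,
    [/\ borel_integrable D g, leb_null [set x | D x /\ f x <> g x] &
        (\int[lebn R n]_(y in vecn R n @^-1` D) (g (vecn R n y))%:E)%E = v%:E].

Definition leb_integrable (R : realType) (n : nat) (D : set 'rV[R]_n)
    (f : 'rV[R]_n -> R) : Prop := exists v, leb_integral_is D f v.

Definition Lsp (R : realType) (n : nat) (s p : R) (u : 'rV[R]_n -> R) : Prop :=
  (forall r : R, 0 < r -> leb_integrable [set x | eucl_norm x < r] u) /\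
  leb_integrable setT (fun x => u x / (1 + eucl_norm x `^ (n%:R + s * p))).

Definition fracp_integrand (R : realType) (n : nat) (s p : R) (u : 'rV[R]_n -> R)
    (x y : 'rV[R]_n) : R :=
  (`|u x - u y| `^ (p - 2) * (u x - u y)) / eucl_norm (x - y) `^ (n%:R + s * p).

Definition fracpL_at (R : realType) (n : nat) (C s p : R) (u : 'rV[R]_n -> R)
    (x : 'rV[R]_n) (L : R) : Prop :=
  exists (I : R -> R) (L' : R),
    [/\ forall e : R, 0 < e ->
          leb_integral_is [set y | e <= eucl_norm (x - y)] (fracp_integrand s p u x) (I e),
        I e @[e --> 0^'+] --> L' & L = C * L'].

(* Main.v *)
(* Let [x] in [Sigma lam] satisfy [w x <= 0] and [w x <= w y] on [Sigma lam].
   Adding to the difference of the integrands of [ulam] and [u] at [y] its value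
   at the reflection of [y] gives, as [t |-> |t|^(p-2) t] increases, a sum that
   is nonpositive, and that vanishes only if [w x = 0 = w y]. Lebesgue measure
   is invariant under the reflection, so if this sum were negative on a set of
   positive measure the truncated integrals would eventually be negative,
   contradicting [0 <= L1 - L2]. Hence [w x = 0] and [w = 0] almost everywhere.
   A negative value of [w] would, by semi-continuity, produce such an [x] with
   [w x < 0]; a zero of [w] in [Om] is such an [x] once [w >= 0]. *)

Require Import Defs.
From HB Require Import structures.
From mathcomp Require Import all_boot all_order all_algebra.
From mathcomp Require Import all_classical all_reals all_analysis.
From mathcomp Require Import measurable_realfun ring lra.
Set Implicit Arguments.
Unset Strict Implicit.
Unset Printing Implicit Defensive.
Import Order.TTheory GRing.Theory Num.Theory.
Import numFieldNormedType.Exports.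
Local Open Scope classical_set_scope.
Local Open Scope ring_scope.

(** * Almost-everywhere comparison of integrals and measure-preserving maps *)

Lemma ae_le_integral d (T : measurableType d) (R : realType)
    (mu : {measure set T -> \bar R}) (f g : T -> \bar R) :
  mu.-integrable setT f -> mu.-integrable setT g ->
  {ae mu, forall z, (f z <= g z)%E} ->
  (\int[mu]_z f z <= \int[mu]_z g z)%E.
Proof.
move=> fi gi [N [mN N0 fgN]].
rewrite (negligible_integral mN measurableT fi N0).
rewrite (negligible_integral mN measurableT gi N0).
have mTN : measurable (setT `\` N) by exact: measurableD.
apply: le_integral.
- exact: mTN.
- exact: (integrableS measurableT mTN _ fi).
- exact: (integrableS measurableT mTN _ gi).
- by move=> z; rewrite inE => -[_ Nz]; apply: contrapT => fg; exact/Nz/fgN.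
Qed.

Section measure_preserving.
Context d (T : measurableType d) (R : realType).
Variables (mu : {measure set T -> \bar R}) (rho : T -> T).
Hypothesis mrho : measurable_fun setT rho.
Hypothesis mu_rho : forall B, measurable B -> mu (rho @^-1` B) = mu B.

Lemma measure_preserving_ae (P : T -> Prop) :
  {ae mu, forall z, P z} -> {ae mu, forall z, P (rho z)}.
Proof.
move=> [N [mN N0 PN]]; exists (rho @^-1` N); split.
- by rewrite -[X in measurable X]setTI; exact: mrho.
- by rewrite mu_rho.
- by move=> z Pz; exact: PN.
Qed.

Lemma measure_preserving_integrable (f : T -> \bar R) :
  mu.-integrable setT f -> mu.-integrable setT (f \o rho).
Proof.
move=> /integrableP[mf foo]; apply/integrableP; split.
  exact: measurableT_comp.
rewrite (_ : (\int[mu]_z `|(f \o rho) z|)%E = (\int[mu]_z `|f z|)%E)//.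
rewrite -[LHS](@ge0_integral_pushforward _ _ _ _ _ _ mrho mu setT
  (abse \o f))//.
  by apply: eq_measure_integral => A mA _; exact: mu_rho.
  exact: measurableT_comp.
by move=> z _; exact: abse_ge0.
Qed.

Lemma measure_preserving_integral (f : T -> \bar R) :
  mu.-integrable setT f -> (\int[mu]_z f (rho z) = \int[mu]_z f z)%E.
Proof.
move=> fi; rewrite -[LHS](@integral_pushforward _ _ _ _ _ _ mrho mu setT f)//.
- by apply: eq_measure_integral => A mA _; exact: mu_rho.
- exact: measurable_int fi.
- by rewrite preimage_setT; exact: measure_preserving_integrable.
Qed.

End measure_preserving.

(** The sign of [f] forces the integral to be exactly zero, and the integral of [|f|] is its
    opposite. *)
Lemma ae_eq0_of_le0 d (T : measurableType d) (R : realType)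
    (mu : {measure set T -> \bar R}) (f : T -> \bar R) :
  mu.-integrable setT f -> {ae mu, forall z, (f z <= 0)%E} ->
  (0 <= \int[mu]_z f z)%E -> {ae mu, forall z, f z = 0%E}.
Proof.
move=> fi f0 If0; have mf := measurable_int _ fi.
have [+ _] := ae_eq_integral_abs mu measurableT mf.
have -> : (\int[mu]_z `|f z|)%E = (\int[mu]_z - f z)%E.
  apply: ae_eq_integral => //.
  - exact: measurableT_comp.
  - exact: measurableT_comp.
  - by apply: filterS f0 => z fz _; rewrite lee0_abs.
have If : (\int[mu]_z f z)%E = 0%E.
  apply/eqP; rewrite eq_le If0 andbT.
  rewrite -[leRHS](@integral0 _ _ _ mu setT).
  apply: ae_le_integral => //; exact: integrable0.
rewrite integralN ?If ?oppe0; last first.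
  by rewrite fin_num_adde_defl// fin_numN integrable_neg_fin_num.
by move=> /(_ erefl); apply: filterS => z /(_ I).
Qed.

(** * Symmetrised truncated integrals and their limit *)

Section antisymmetric_limit.
Context d (T : measurableType d) (R : realType).
Variables (mu : {measure set T -> \bar R}) (rho : T -> T).
Hypothesis mrho : measurable_fun setT rho.
Hypothesis mu_rho : forall B, measurable B -> mu (rho @^-1` B) = mu B.
(** In the application [A k] is the complement of a ball about [x] of shrinking radius, [F] the
    difference of the two integrands, [h k] an integrable representative of [F] on [A k], and [J k]
    the truncated integral. *)
Variables (A : (set T)^nat) (F : T -> R) (h : nat -> T -> R) (J : nat -> R).
Variable l : R.
Hypothesis mA : forall k, measurable (A k).
Hypothesis ndA : nondecreasing_seq A.
Hypothesis coverA : forall z, A 0%N z \/ A 0%N (rho z).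
Hypothesis bigcupA : {ae mu, forall z, exists k, A k z}.
Hypothesis F0 : {ae mu, forall z, F z + F (rho z) <= 0}.
Hypothesis ih : forall k, mu.-integrable (A k) (EFin \o h k).
Hypothesis hF : forall k, {ae mu, forall z, A k z -> F z = h k z}.
Hypothesis Jh : forall k, (\int[mu]_(z in A k) (h k z)%:E)%E = (J k)%:E.
Hypothesis Jl : J @ \oo --> l.
Hypothesis l0 : 0 <= l.

Let H k z : R := if z \in A k then h k z else 0.
(** [P] keeps the symmetrised sum only for pairs [z], [rho z] lying both in [A 0]; [err k] pays for
    the pairs of which just one point has entered [A k]. *)
Let E0 := A 0%N `&` rho @^-1` A 0%N.
Let P z : R := (H 0%N z + H 0%N (rho z)) * \1_E0 z.
Let err k z : R :=
  \1_(~` A k) z * `|H 0%N (rho z)| + \1_(~` A k) (rho z) * `|H 0%N z|.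

Let mE0 : measurable E0.
Proof.
by apply: measurableI => //; rewrite -[X in measurable X]setTI; exact: mrho.
Qed.

Let HE k : EFin \o H k = (EFin \o h k) \_ (A k).
Proof. by rewrite restrict_EFin. Qed.

Let iH k : mu.-integrable setT (EFin \o H k).
Proof. by rewrite HE; exact/(integrable_mkcond _ (mA k)).1/ih. Qed.

Let iHr k : mu.-integrable setT (EFin \o (H k \o rho)).
Proof. exact: (measure_preserving_integrable mrho mu_rho (iH k)). Qed.

Let mH k : measurable_fun setT (H k).
Proof. by apply/measurable_EFinP; exact: (measurable_int _ (iH k)). Qed.

Let mHr k : measurable_fun setT (H k \o rho).
Proof. exact: measurableT_comp. Qed.

Let indicE' (B : set T) z : \1_B z = (if z \in B then 1 else 0) :> R.
Proof. by rewrite indicE; case: (z \in B). Qed.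

(* The symmetrised truncated integrand on the left has integral [2 J k]. *)
Let sum_le k : {ae mu, forall z, H k z + H k (rho z) <= P z + err k z}.
Proof.
have hr := measure_preserving_ae mrho mu_rho.
have hFr j : {ae mu, forall z, (A j z -> F z = h j z) /\
    (A j (rho z) -> F (rho z) = h j (rho z))}.
  exact: filterI (hF j) (hr _ (hF j)).
move: F0 (hFr 0%N) (hFr k); apply: filterS3 => z Fz [h0 h0r] [hk hkr].
have sub x : A 0%N x -> A k x by have /subsetPset := ndA (leq0n k); exact.
rewrite /P /err /H /E0 !indicE' !in_setI !in_setC.
rewrite [z \in rho @^-1` _](_ : _ = (rho z \in A 0%N)); last first.
  by apply/idP/idP; rewrite !inE.
(* If both points are in [A 0], the sum is [P z]. If only one is, either its partner is in [A k] and
   [F0] bounds the pair by 0, or its lone value is at most [err k z]. [coverA] excludes the last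
   case. *)
have [z0|z0] := boolP (z \in A 0%N);
  have [r0|r0] := boolP (rho z \in A 0%N) => /=.
- rewrite (mem_set (sub _ (set_mem z0))) (mem_set (sub _ (set_mem r0))) /=.
  rewrite -(h0 (set_mem z0)) -(h0r (set_mem r0)).
  rewrite -(hk (sub _ (set_mem z0))) -(hkr (sub _ (set_mem r0))); lra.
- rewrite (mem_set (sub _ (set_mem z0))) /=.
  have [rk|rk] := boolP (rho z \in A k) => /=.
    rewrite -(hk (sub _ (set_mem z0))) -(hkr (set_mem rk)) normr0; lra.
  rewrite -(hk (sub _ (set_mem z0))) -(h0 (set_mem z0)) normr0.
  have := ler_norm (F z); lra.
- rewrite (mem_set (sub _ (set_mem r0))) /=.
  have [rk|rk] := boolP (z \in A k) => /=.
    rewrite -(hk (set_mem rk)) -(hkr (sub _ (set_mem r0))) normr0; lra.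
  rewrite -(hkr (sub _ (set_mem r0))) -(h0r (set_mem r0)) normr0.
  have := ler_norm (F (rho z)); lra.
- by case: (coverA z) => /mem_set h'; [rewrite h' in z0|rewrite h' in r0].
Qed.

Let indic_le1 (B : set T) z : 0 <= (\1_B z : R) <= 1.
Proof. by rewrite indicE'; case: ifP; rewrite ?lexx ?ler01. Qed.

Let mP : measurable_fun setT P.
Proof.
apply: measurable_funM; last exact: measurable_indic.
exact: (measurable_funD (mH 0%N) (mHr 0%N)).
Qed.

Let merr k : measurable_fun setT (err k).
Proof.
have mabs (f : T -> R) : measurable_fun setT f ->
    measurable_fun setT (fun z => `|f z|).
  by move=> mf; exact: measurableT_comp.
have mI : measurable_fun setT (\1_(~` A k) : T -> R).
  exact/measurable_indic/measurableC.
apply: measurable_funD; apply: measurable_funM => //.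
- exact: mabs (mHr 0%N).
- exact: (measurableT_comp mI mrho).
- exact: mabs (mH 0%N).
Qed.

(** A majorant independent of [k] for dominated convergence; the factor 2 accounts for [P] and
    [err k] separately. *)
Let G z : R := (`|H 0%N z| + `|H 0%N (rho z)|) *+ 2.

Let iG : mu.-integrable setT (EFin \o G).
Proof.
have i1 : mu.-integrable setT
    (EFin \o (fun z => `|H 0%N z| + `|H 0%N (rho z)|)).
  apply: (@integrableD _ _ _ mu setT measurableT (fun z => `|H 0%N z|%:E)
    (fun z => `|H 0%N (rho z)|%:E)) => //.
  - exact: integrable_abse (iH 0%N).
  - exact: integrable_abse (iHr 0%N).
have := integrableD measurableT i1 i1.
by apply: eq_integrable => // z _; rewrite /G /= mulr2n EFinD.
Qed.

Let le_G k z : `|P z + err k z| <= G z.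
Proof.
rewrite /P /err /G; have /andP[e0 e1] := indic_le1 E0 z.
have /andP[a0 a1] := indic_le1 (~` A k) z.
have /andP[b0 b1] := indic_le1 (~` A k) (rho z).
apply: le_trans (ler_normD _ _) _; rewrite mulr2n; apply: lerD.
  rewrite normrM (ger0_norm e0).
  by apply: le_trans (ler_normD _ _); rewrite ler_piMr.
rewrite ger0_norm ?addr_ge0 ?mulr_ge0// addrC.
by apply: lerD; rewrite ler_piMl.
Qed.

(** For almost every [z], both [z] and [rho z] lie in [A k] from some [k] on, after which [err k z]
    is 0. *)
Let err_cvg0 : {ae mu, forall z, (P z + err k z)%:E @[k --> \oo] --> (P z)%:E}.
Proof.
have := measure_preserving_ae mrho mu_rho bigcupA; move: bigcupA.
apply: filterS2 => z [k1 Ak1] [k2 Ak2].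
apply: cvg_near_cst; near=> k.
have sub j x : (j <= k)%N -> A j x -> A k x by move=> /ndA/subsetPset; exact.
have Akz : A k z by apply: (sub k1) => //; near: k; exact: nbhs_infty_ge.
have Akrz : A k (rho z) by apply: (sub k2) => //; near: k; exact: nbhs_infty_ge.
by rewrite /err !indicE' !in_setC (mem_set Akz) (mem_set Akrz) /= !mul0r !addr0.
Unshelve. all: end_near. Qed.

(* Otherwise [lim J = 1/2 lim int (H k + H k o rho) <= 1/2 int P < 0]. *)
Lemma antisymmetric_limit_ae0 :
  {ae mu, forall z, A 0%N z -> A 0%N (rho z) -> F z + F (rho z) = 0}.
Proof.
have sumE k : (\int[mu]_z (H k z + H k (rho z))%:E = (J k + J k)%:E)%E.
  have HJ : (\int[mu]_z (H k z)%:E = (J k)%:E)%E.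
    rewrite -Jh [RHS]integral_mkcond; apply: eq_integral => z _.
    by rewrite /H /patch; case: ifP.
  rewrite EFinD -[in X in _ = (X + _)%E]HJ -HJ.
  rewrite -[in X in _ = (_ + X)%E]
    (measure_preserving_integral mrho mu_rho (iH k)).
  by rewrite -(integralD measurableT (iH k) (iHr k)).
have mPe k : measurable_fun setT (fun z => (P z + err k z)%:E).
  by apply/measurable_EFinP; exact: measurable_funD.
have mPE : measurable_fun setT (fun z => (P z)%:E) by exact/measurable_EFinP.
have [|iP _ cvgP] := dominated_convergence measurableT mPe mPE _ iG
  (aeW _ (fun z k _ => le_G k z)).
  by move: err_cvg0; apply: filterS.
have ierr k : mu.-integrable setT (EFin \o (fun z => P z + err k z)).
  apply: le_integrable iG => //.
    by apply/measurable_EFinP; exact: measurable_funD.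
  move=> z _ /=; rewrite lee_fin; apply: le_trans (le_G k z) _.
  exact: ler_norm.
(* Pass to the limit in [2 J k <= int (P + err k)]: the left side tends to [2 l >= 0], the right
   side to the integral of [P]. *)
have P0 : (0 <= \int[mu]_z (P z)%:E)%E.
  have Jl2 : (J k + J k)%:E @[k --> \oo] --> (l + l)%:E.
    by apply: cvg_EFin; [exact: nearW|exact: cvgD].
  apply: (@le_trans _ _ (l + l)%:E); first by rewrite lee_fin addr_ge0.
  apply: lee_cvg_to Jl2 cvgP _; apply: nearW => k.
  rewrite -sumE; apply: ae_le_integral.
  - have := integrableD measurableT (iH k) (iHr k).
    by apply: eq_integrable => // z _; rewrite EFinD.
  - exact: ierr.
  - by move: (sum_le k); apply: filterS => z; rewrite lee_fin.
have hr := measure_preserving_ae mrho mu_rho.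
have PE : {ae mu, forall z, P z = (F z + F (rho z)) * \1_E0 z}.
  have := hr _ (hF 0%N); have := hF 0%N; apply: filterS2 => z h0 h0r.
  rewrite /P indicE'; case: ifPn => [|_]; last by rewrite !mulr0.
  rewrite in_setE => -[Az Arz].
  by rewrite /H (mem_set Az) (mem_set (Arz : A 0%N (rho z))) -h0// -h0r.
have Ple0 : {ae mu, forall z, ((EFin \o P) z <= 0)%E}.
  move: PE F0; apply: filterS2 => z + Fz /=; rewrite lee_fin => ->.
  by rewrite indicE'; case: ifP; rewrite ?mulr1 ?mulr0.
have := ae_eq0_of_le0 iP Ple0 P0; move: PE; apply: filterS2 => z + + Az Arz.
by rewrite /= => -> []; rewrite indicE' mem_set// mulr1.
Qed.

End antisymmetric_limit.

(** * The reflection on the nested product and its invariance of measure *)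

Definition reflect_car (R : realType) (n : nat) (lam : R)
  (y : lebn_car R n.+1) : lebn_car R n.+1 := (2 * lam - y.1, y.2).

Section lebesgue_reflection.
Variables (R : realType) (n : nat).
Implicit Types (lam : R) (y : lebn_car R n.+1).

Lemma vecnS_ord0 y : vecn R n.+1 y 0 ord0 = y.1.
Proof.
rewrite /vecn /= mxE; case: splitP => [j _|j /eqP]; first by rewrite mxE.
by [].
Qed.

Lemma vecn_reflect lam y :
  vecn R n.+1 (reflect_car lam y) = refl lam (vecn R n.+1 y).
Proof.
apply/rowP => i; rewrite [RHS]mxE.
have [i0|i0] := eqVneq (i : nat) 0%N.
  have -> : i = ord0 by exact/val_inj.
  by rewrite !vecnS_ord0.
rewrite /vecn /= !mxE; case: splitP => [j ij|//].
by move: i0; rewrite ij; case: j {ij} => -[].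
Qed.

Lemma measurable_reflect_car lam : measurable_fun setT (@reflect_car R n lam).
Proof.
apply/measurable_fun_pairP; split; first exact: measurable_funB.
exact: (@measurable_snd _ _ _ (lebn_car R n)).
Qed.

(** By uniqueness of Lebesgue measure it suffices to test half-open intervals, whose preimages are
    intervals of the same length. *)
Lemma lebesgue_measure_affN lam (A : set R) : measurable A ->
  lebesgue_measure ((fun t : R => 2 * lam - t) @^-1` A) = lebesgue_measure A.
Proof.
move=> mA.
apply/esym/(@lebesgue_measure_unique _ (pushforward lebesgue_measure
  ((fun t => 2 * lam - t) : _ -> measurableTypeR R))) => //=.
  exact: measurable_funB.
move=> _ _ [[a b]] _ <-.
rewrite /pushforward.
rewrite (_ : _ @^-1` _ = `[2 * lam - b, 2 * lam - a[%classic).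
  rewrite !lebesgue_measure_itv /= !lte_fin.
  have -> : (2 * lam - b < 2 * lam - a) = (a < b) by apply/idP/idP; lra.
  by case: ifP => // _; rewrite -!EFinD; congr EFin; lra.
apply/seteqP; split => t /=; rewrite !in_itv /= => /andP[? ?];
  apply/andP; split; lra.
Qed.


Lemma lebn_setX A (B : set (lebn_car R n)) : measurable A -> measurable B ->
  lebn R n.+1 (A `*` B) = (lebesgue_measure A * lebn R n B)%E.
Proof. exact: product_measure1E. Qed.

(** By uniqueness of the product measure it suffices to test rectangles, where only the first side
    is reflected. *)
Lemma lebn_reflect lam (B : set (lebn_car R n.+1)) : measurable B ->
  lebn R n.+1 (reflect_car lam @^-1` B) = lebn R n.+1 B.
Proof.
move=> mB; apply/esym.
apply: (@product_measure_unique _ _ _ _ _ lebesgue_measure (lebn R n)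
  (pushforward (lebn R n.+1) (@reflect_car R n lam))) => //.
  exact: measurable_reflect_car.
move=> ? A0 B0 mA0 mB0.
change (lebn R n.+1 (((fun t : R => 2 * lam - t) @^-1` A0) `*` B0) =
  (lebesgue_measure A0 * lebn R n B0)%E).
have mf : measurable_fun setT ((fun t => 2 * lam - t) : _ -> measurableTypeR R).
  exact: measurable_funB.
rewrite lebn_setX ?lebesgue_measure_affN//.
by rewrite -[X in measurable X]setTI; exact: mf.
Qed.

Lemma lebn_ae_neq (a : R) : {ae lebn R n.+1, forall y, y.1 != a}.
Proof.
exists ([set a] `*` setT); split.
- exact: measurableX.
- by rewrite lebn_setX// lebesgue_measure_set1 mul0e.
- by move=> y /= /negP; rewrite negbK => /eqP.
Qed.

End lebesgue_reflection.

(** * Non-null sets and measurability for the n-dimensional measure *)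

Section lebn_theory.
Variable R : realType.

Lemma lebn_setT_neq0 n : lebn R n setT != 0%E.
Proof.
elim: n => [|n IHn]; first by rewrite /lebn /= diracT onee_neq0.
rewrite -setXTT lebn_setX// mule_neq0// -set_itvNyy lebesgue_measure_itv/=.
by [].
Qed.

(** Allows a statement independent of the point, known almost everywhere on a half-space, to be
    concluded outright. *)
Lemma lebn_halfspace_not_null n (a : R) (N : set (lebn_car R n.+1)) :
  measurable N -> (forall y : lebn_car R n.+1, y.1 < a -> N y) ->
  lebn R n.+1 N != 0%E.
Proof.
move=> mN aN; apply/eqP => N0.
have : lebn R n.+1 (`]-oo, a[%classic `*` setT) = 0%E.
  apply: (subset_measure0 _ mN _ N0); first exact: measurableX.
  by move=> y [/=]; rewrite in_itv /= => ya _; exact: aN.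
move=> /eqP; apply/negP; rewrite lebn_setX// mule_neq0 ?lebn_setT_neq0//.
by rewrite lebesgue_measure_itv /= ltNyr.
Qed.

Lemma measurable_vecn n (i : 'I_n) :
  measurable_fun setT (fun y => vecn R n y 0 i).
Proof.
elim: n i => [[]//|n IHn] i.
have [j ij|i0] := unliftP ord0 i.
  rewrite (_ : (fun y => _) = (fun z => vecn R n z 0 j) \o snd); last first.
    apply/funext => y; rewrite /vecn /= mxE ij.
    case: splitP => k; first by case: k => -[].
    by rewrite /= /bump /= !add1n => -[jk]; congr (_ _ _); exact/val_inj.
  exact: measurableT_comp (IHn j) (@measurable_snd _ _ _ (lebn_car R n)).
rewrite (_ : (fun y => _) = fst); first exact: measurable_fst.
by apply/funext => y; rewrite i0 vecnS_ord0.
Qed.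

Lemma measurable_eucl_dist n (x : 'rV[R]_n) :
  measurable_fun setT (fun y => eucl_norm (x - vecn R n y)).
Proof.
have ms : measurable_fun setT (@Num.sqrt R).
  by apply: continuous_measurable_fun; exact: sqrt_continuous.
apply: (measurableT_comp ms).
apply: measurable_sum => i.
apply: measurable_funX.
rewrite (_ : (fun y => _) = (fun y => x 0 i - vecn R n y 0 i)).
  by apply: measurable_funB => //; exact: measurable_vecn.
by apply/funext => y; rewrite !mxE.
Qed.

Lemma measurable_dist_ge n (x : 'rV[R]_n) (e : R) :
  measurable (vecn R n @^-1` [set y | e <= eucl_norm (x - y)]).
Proof.
rewrite -[X in measurable X]setTI.
rewrite (_ : vecn R n @^-1` _ =
  (fun y => eucl_norm (x - vecn R n y)) @^-1` `[e, +oo[%classic); last first.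
  by apply/seteqP; split => y /=; rewrite in_itv/= andbT.
exact: measurable_eucl_dist.
Qed.

End lebn_theory.

(** * Monotonicity of the signed power and the pointwise inequality *)

Section signed_power.
Variables (R : realType) (p : R).
Hypothesis p1 : 1 < p.

Let phi (t : R) := `|t| `^ (p - 2) * t.

Let phiE t : 0 <= t -> phi t = t `^ (p - 1).
Proof.
rewrite le_eqVlt => /predU1P[<-|t0].
  by rewrite /phi mulr0 powR0// subr_eq0 gt_eqF.
rewrite /phi gtr0_norm// -{2}(powRr1 (ltW t0)) -powRD.
  by congr (_ `^ _); lra.
by rewrite (gt_eqF t0) implybT.
Qed.

Let phiN t : phi (- t) = - phi t.
Proof. by rewrite /phi normrN mulrN. Qed.

Lemma signed_power_lt a b : a < b ->
  `|a| `^ (p - 2) * a < `|b| `^ (p - 2) * b.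
Proof.
have mono x y : 0 <= x -> x < y -> phi x < phi y.
  move=> x0 xy; have y0 : 0 <= y by lra.
  by rewrite !phiE//; apply: gt0_ltr_powR => //; rewrite ?subr_gt0// nnegrE.
have phi0 : phi 0 = 0 by rewrite /phi mulr0.
rewrite -/(phi a) -/(phi b) => ab; have [a0|a0] := leP 0 a; first exact: mono.
rewrite -[a]opprK (phiN (- a)); have [b0|b0] := leP 0 b.
  have : phi 0 < phi (- a) by apply: mono; lra.
  have [<-|b0'] := eqVneq 0 b; first by rewrite phi0; lra.
  have : phi 0 < phi b by apply: mono => //; rewrite lt_neqAle b0'.
  by rewrite phi0; lra.
by rewrite -[b]opprK (phiN (- b)) ltrN2; apply: mono; lra.
Qed.

Lemma signed_power_le a b : a <= b ->
  `|a| `^ (p - 2) * a <= `|b| `^ (p - 2) * b.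
Proof.
by rewrite le_eqVlt => /predU1P[->//|/signed_power_lt/ltW].
Qed.

(* With [a = u_lam x], [b = u x], [c = u_lam y], [d = u y], this is the sum of
   the integrands at [y] and at its reflection. It equals
   [D (1/r - 1/r') + (D + D') / r'] for [D], [D'] the two differences of
   powers, where [D <= 0] and [D + D' <= 0]. *)
Lemma reflected_sum_le0 (a b c d r r' : R) :
  0 < r -> r < r' -> a <= b -> a - b <= c - d ->
  let S := (phi (a - c) - phi (b - d)) / r + (phi (a - d) - phi (b - c)) / r' in
  S <= 0 /\ (S = 0 -> a = b /\ c = d).
Proof.
move=> r0 rr' ab abcd S.
have ri : r'^-1 < r^-1 by rewrite ltf_pV2// posrE; lra.
have ri0 : 0 < r'^-1 by rewrite invr_gt0; lra.
have D0 : phi (a - c) <= phi (b - d) by apply: signed_power_le; lra.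
have ac : phi (a - c) <= phi (b - c) by apply: signed_power_le; lra.
have ad : phi (a - d) <= phi (b - d) by apply: signed_power_le; lra.
set x1 := phi (a - c) in S D0 ac *; set x2 := phi (b - d) in S D0 ad *.
set x3 := phi (a - d) in S ad *; set x4 := phi (b - c) in S ac *.
have SE : S = (x1 - x2) * (r^-1 - r'^-1) + ((x1 - x4) + (x3 - x2)) * r'^-1.
  by rewrite /S; ring.
have S1 : (x1 - x2) * (r^-1 - r'^-1) <= 0 by rewrite mulr_le0_ge0//; lra.
have S2 : ((x1 - x4) + (x3 - x2)) * r'^-1 <= 0.
  by rewrite mulr_le0_ge0//; lra.
split; first lra.
move=> S0; have {}S1 : (x1 - x2) * (r^-1 - r'^-1) = 0 by lra.
have {}S2 : ((x1 - x4) + (x3 - x2)) * r'^-1 = 0 by lra.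
move/eqP : S2; rewrite mulf_eq0 (gt_eqF ri0) orbF => /eqP S2.
move/eqP : S1; rewrite mulf_eq0 subr_eq0 [_ - _ == 0]subr_eq0 (gt_eqF ri) orbF.
move=> /eqP S1.
(* [a < b] would make [x1 - x4] negative, while [x3 - x2 <= 0] and their sum is 0. *)
have eab : a = b.
  apply/eqP; rewrite eq_le ab leNgt; apply/negP => ltab.
  have : x1 < x4 by apply: signed_power_lt; lra.
  lra.
(* With [a = b] the hypothesis gives [d <= c], and [d < c] would contradict [x1 = x2]. *)
split=> //; apply/eqP; rewrite eq_le; apply/andP; split; last lra.
rewrite leNgt; apply/negP => ltdc.
have : x1 < x2 by apply: signed_power_lt; lra.
lra.
Qed.

End signed_power.

(** * Geometry of the reflection and the Euclidean norm *)

Section reflection_geometry.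
Variables (R : realType) (n : nat) (lam : R).
Implicit Types x y : 'rV[R]_n.+1.

Lemma reflK x : refl lam (refl lam x) = x.
Proof. by apply/rowP => i; rewrite !mxE; case: eqP => // _; rewrite subKr. Qed.

Lemma refl_ord0 x : refl lam x 0 ord0 = 2 * lam - x 0 ord0.
Proof. by rewrite mxE. Qed.

Lemma Sigma_refl x : lam < x 0 ord0 -> Sigma lam (refl lam x).
Proof. by rewrite /Sigma /= refl_ord0 => ?; lra. Qed.

Lemma refl_hyperplane x : x 0 ord0 = lam -> refl lam x = x.
Proof.
move=> x0; apply/rowP => i; rewrite mxE; case: eqP => // i0.
rewrite (_ : i = ord0) ?x0; last exact/val_inj.
by rewrite mulr2n mulrDl mul1r addrK.
Qed.

Lemma le_coord_eucl_norm m (x : 'rV[R]_m) i : `|x 0 i| <= eucl_norm x.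
Proof.
rewrite /eucl_norm -sqrtr_sqr ler_wsqrtr// (bigD1 i)//= lerDl.
by apply: sumr_ge0 => j _; exact: sqr_ge0.
Qed.

Lemma eucl_norm_ge0 m (x : 'rV[R]_m) : 0 <= eucl_norm x.
Proof. exact: sqrtr_ge0. Qed.

Lemma le_norm_eucl_norm m (x : 'rV[R]_m) : `|x| <= eucl_norm x.
Proof.
have [->|x0] := eqVneq `|x| 0; first exact: eucl_norm_ge0.
have [[i j] xij] := mx_norm_neq0 x0.
rewrite (xij : `|x| = `|x i j|) ord1; exact: le_coord_eucl_norm.
Qed.

(** Only the first coordinate changes, and the squared distances differ by
    [4 (lam - x_1) (lam - y_1) > 0]. *)
Lemma eucl_dist_refl_lt x y : Sigma lam x -> Sigma lam y ->
  eucl_norm (x - y) < eucl_norm (x - refl lam y).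
Proof.
rewrite /Sigma /= => xl yl.
have ltS : \sum_i (x - y) 0 i ^+ 2 < \sum_i (x - refl lam y) 0 i ^+ 2.
  rewrite !big_ord_recl; apply: ltr_leD; last first.
    by apply: ler_sum => i _; rewrite !mxE.
  rewrite !mxE /=; nra.
rewrite /eucl_norm ltr_sqrt//; apply: le_lt_trans ltS.
by apply: sumr_ge0 => j _; exact: sqr_ge0.
Qed.

Lemma eucl_dist_gt0 x y : x 0 ord0 != y 0 ord0 -> 0 < eucl_norm (x - y).
Proof.
move=> xy; apply: lt_le_trans (le_coord_eucl_norm _ ord0).
by rewrite normr_gt0 !mxE subr_eq0.
Qed.

End reflection_geometry.

(** * Minimum of a semi-continuous function, and differences of integrals *)

Lemma lsc_compact_min (T : topologicalType) (R : realType) (K : set T)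
    (w : T -> R) : compact K -> K !=set0 ->
  (forall x, K x -> forall e : R, 0 < e ->
    \forall y \near x, K y -> w x - e < w y) ->
  exists2 x, K x & forall y, K y -> w x <= w y.
Proof.
move=> cK K0 lscw.
(* The sublevel sets are nested, hence a filter base; any cluster point of it in [K] is a
   minimiser. *)
pose F := filter_from K (fun z => [set y | K y /\ w y <= w z]).
have FF : ProperFilter F.
  apply: filter_from_proper; last by move=> z Kz; exists z.
  apply: filter_from_filter => // x y Kx Ky; have [xy|yx] := leP (w x) (w y).
    by exists x => // z [Kz zx]; do 2 split => //; exact: le_trans xy.
  by exists y => // z [Kz zx]; do 2 split => //; exact: le_trans (ltW yx).
have [|x [Kx clx]] := cK F FF.
  by case: K0 => z Kz; exists z => // y [].
exists x => // y Ky; rewrite leNgt; apply/negP => wyx.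
have Fy : F [set z | K z /\ w z <= w y] by exists y.
have e0 : 0 < w x - w y by rewrite subr_gt0.
have [z [[Kz wzy] /(_ Kz)]] := clx _ _ Fy (lscw x Kx _ e0).
by rewrite subKr ltNge wzy.
Qed.

(** Provides an integrable representative [h] of the difference, as the antisymmetric limit argument
    requires. *)
Lemma leb_integral_isB (R : realType) (n : nat) (D : set 'rV[R]_n)
    (f1 f2 : 'rV[R]_n -> R) (v1 v2 : R) :
  measurable (vecn R n @^-1` D) ->
  leb_integral_is D f1 v1 -> leb_integral_is D f2 v2 ->
  exists h : lebn_car R n -> R,
    [/\ (lebn R n).-integrable (vecn R n @^-1` D) (EFin \o h),
        {ae lebn R n, forall z, D (vecn R n z) ->
          f1 (vecn R n z) - f2 (vecn R n z) = h z} &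
        (\int[lebn R n]_(z in vecn R n @^-1` D) (h z)%:E)%E = (v1 - v2)%:E].
Proof.
move=> mD.
have ae f g : leb_null [set x | D x /\ f x <> g x] ->
    {ae lebn R n, forall z, D (vecn R n z) -> f (vecn R n z) = g (vecn R n z)}.
  move=> [B [mB B0 sB]]; exists B; split => // z fgz; apply: sB.
  by apply/not_implyP.
move=> [g1 [ig1 /ae ae1 I1]] [g2 [ig2 /ae ae2 I2]].
exists (fun z => g1 (vecn R n z) - g2 (vecn R n z)); split.
- have := integrableB mD ig1 ig2.
  by apply: eq_integrable => // z _; rewrite EFinB.
- by move: ae1 ae2; apply: filterS2 => z e1 e2 Dz; rewrite e1// e2.
- rewrite EFinB -I1 -I2 -(integralB mD ig1 ig2).
  by apply: eq_integral => z _; rewrite EFinB.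
Qed.

(** * The operator inequality at a nonpositive minimum *)

Section min_point.
Variables (R : realType) (n : nat) (s p lam C : R) (u : 'rV[R]_n.+1 -> R).
Hypotheses (s01 : 0 < s < 1) (p1 : 1 < p) (C0 : 0 < C).
Let ulam := fun x => u (refl lam x).
Let w := fun x => ulam x - u x.

Let wN x : w (refl lam x) = - w x.
Proof. by rewrite /w /ulam reflK opprB. Qed.

Variable x : 'rV[R]_n.+1.
Hypotheses (xlam : Sigma lam x) (wx0 : w x <= 0).
Hypothesis wmin : forall y, Sigma lam y -> w x <= w y.

Let N := n.+1%:R + s * p.

Let N0 : 0 < N.
Proof.
move: s01 => /andP[s0 _]; apply: addr_gt0; first by rewrite ltr0n.
by rewrite mulr_gt0// (lt_trans ltr01 p1).
Qed.

Let F y := fracp_integrand s p ulam x y - fracp_integrand s p u x y.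

(** Reflection exchanges [ulam] and [u], so the four terms regroup by kernel into the shape of
    [reflected_sum_le0]. *)
Let FE y : F y + F (refl lam y) =
  (`|ulam x - ulam y| `^ (p - 2) * (ulam x - ulam y) -
   `|u x - u y| `^ (p - 2) * (u x - u y)) / eucl_norm (x - y) `^ N +
  (`|ulam x - u y| `^ (p - 2) * (ulam x - u y) -
   `|u x - ulam y| `^ (p - 2) * (u x - ulam y)) /
    eucl_norm (x - refl lam y) `^ N.
Proof.
have e1 : ulam (refl lam y) = u y by rewrite /ulam reflK.
have e2 : u (refl lam y) = ulam y by [].
have split_div (a b c d r r' : R) :
  a / r - b / r + (c / r' - d / r') = (a - b) / r + (c - d) / r'.
  by rewrite !mulrBl.
by rewrite -split_div /F /fracp_integrand -/N e1 e2.
Qed.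

Let F_Sigma y : Sigma lam y -> x 0 ord0 != y 0 ord0 ->
  F y + F (refl lam y) <= 0 /\
  (F y + F (refl lam y) = 0 -> w x = 0 /\ w y = 0).
Proof.
move=> yl xy; rewrite FE.
have r0 := eucl_dist_gt0 xy; have rr' := eucl_dist_refl_lt xlam yl.
have := @reflected_sum_le0 _ _ p1 (ulam x) (u x) (ulam y) (u y)
  (eucl_norm (x - y) `^ N) (eucl_norm (x - refl lam y) `^ N).
move=> [||||Sle0 S0].
- exact: powR_gt0.
- by apply: gt0_ltr_powR => //; rewrite nnegrE ?eucl_norm_ge0.
- by rewrite -subr_le0.
- exact: wmin.
split=> // /S0[e1 e2].
by rewrite /w e1 e2 !subrr.
Qed.

Let F_le0 (y : 'rV[R]_n.+1) :
  x 0 ord0 != y 0 ord0 -> x 0 ord0 != refl lam y 0 ord0 ->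
  F y + F (refl lam y) <= 0.
Proof.
move=> xy xry; have [yl|yl|yl] := ltgtP (y 0 ord0) lam.
- by have [] := F_Sigma yl xy.
- have [] := F_Sigma (Sigma_refl yl) xry.
  by rewrite (reflK lam y) => Fry _; rewrite [X in X <= _]addrC; exact: Fry.
(* On the hyperplane [y] is fixed: both kernels agree, and [ulam x <= u x] decides the sign. *)
- have ry := refl_hyperplane yl; rewrite FE ry /ulam ry -mulrDl.
  rewrite mulr_le0_ge0 ?invr_ge0 ?powR_ge0//.
  have : `|u (refl lam x) - u y| `^ (p - 2) * (u (refl lam x) - u y) <=
      `|u x - u y| `^ (p - 2) * (u x - u y).
    by apply: signed_power_le => //; rewrite lerD2r -subr_le0.
  lra.
Qed.

(** One of [y] and its reflection is not in [Sigma lam], and [x] is at distance [lam - x_1] from the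
    hyperplane. This supplies [coverA]. *)
Let dist_refl (y : 'rV[R]_n.+1) (e : R) : e <= lam - x 0 ord0 ->
  e <= eucl_norm (x - y) \/ e <= eucl_norm (x - refl lam y).
Proof.
move=> el; have [yl|yl] := leP lam (y 0 ord0); [left|right].
  apply: le_trans (le_coord_eucl_norm _ ord0).
  by rewrite ler_normr; apply/orP; right; rewrite !mxE; lra.
apply: le_trans (le_coord_eucl_norm _ ord0).
by rewrite ler_normr; apply/orP; right; rewrite !mxE /=; lra.
Qed.

(** [k] drives the truncation radius to 0; [j] shifts the starting radius, so that the sets [A j 0]
    exhaust almost all of the space. The factor keeps every radius within the range of
    [dist_refl]. *)
Let rad (j k : nat) : R := (lam - x 0 ord0) * harmonic (k + j)%N.

Let harmonic_gt0 k : 0 < harmonic k :> R.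
Proof. by rewrite /harmonic /= invr_gt0 ltr0n. Qed.

Let rad_gt0 j k : 0 < rad j k.
Proof. by rewrite mulr_gt0// subr_gt0. Qed.

Let rad_le j k k' : (k <= k')%N -> rad j k' <= rad j k.
Proof.
move=> kk'; rewrite ler_wpM2l ?subr_ge0 ?(ltW xlam)//.
by rewrite /harmonic /= lef_pV2 ?posrE ?ltr0n// ler_nat ltnS leq_add2r.
Qed.

Let rad_cvg0 j : rad j @ \oo --> 0.
Proof.
rewrite -[X in _ --> X](mulr0 (lam - x 0 ord0)); apply: cvgMr => //.
exact: cvg_comp (cvg_addnr j) cvg_harmonic.
Qed.

Let A j k := vecn R n.+1 @^-1` [set y | rad j k <= eucl_norm (x - y)].

Let exists_A j z : x 0 ord0 != vecn R n.+1 z 0 ord0 -> exists k, A j k z.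
Proof.
move=> /eucl_dist_gt0 xz.
have /cvgrPdist_lt/(_ _ xz)[k _ /(_ k (leqnn k))] := rad_cvg0 j.
by rewrite sub0r normrN gtr0_norm// => /ltW ?; exists k.
Qed.

Variables (L1 L2 : R).
Hypotheses (HL1 : fracpL_at C s p ulam x L1) (HL2 : fracpL_at C s p u x L2).
Hypothesis L12 : 0 <= L1 - L2.

Let ae_neq : {ae lebn R n.+1, forall z, x 0 ord0 != vecn R n.+1 z 0 ord0}.
Proof.
have := lebn_ae_neq n (x 0 ord0); apply: filterS => z.
by rewrite vecnS_ord0 eq_sym.
Qed.

Let ae_neqr :
  {ae lebn R n.+1, forall z, x 0 ord0 != refl lam (vecn R n.+1 z) 0 ord0}.
Proof.
have := measure_preserving_ae (@measurable_reflect_car R n lam)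
  (@lebn_reflect R n lam) ae_neq.
by apply: filterS => z; rewrite vecn_reflect.
Qed.

Let ae_sum0 j : {ae lebn R n.+1, forall z, A j 0%N z ->
  A j 0%N (reflect_car lam z) ->
  F (vecn R n.+1 z) + F (refl lam (vecn R n.+1 z)) = 0}.
Proof.
have [I1 [L1' [HI1 cvg1 L1E]]] := HL1; have [I2 [L2' [HI2 cvg2 L2E]]] := HL2.
have L0 : 0 <= L1' - L2' by rewrite -(pmulr_rge0 _ C0) mulrBr -L1E -L2E.
have /choice[h hP] k := leb_integral_isB (measurable_dist_ge x (rad j k))
  (HI1 _ (rad_gt0 j k)) (HI2 _ (rad_gt0 j k)).
(* The one-sided limits in the principal values are taken along the sequence [rad j]. *)
have Icvg : (fun k => I1 (rad j k) - I2 (rad j k)) @ \oo --> L1' - L2'.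
  by apply: cvgB; [move/cvg_at_rightP : cvg1|move/cvg_at_rightP : cvg2];
    apply; split => // k; exact: rad_gt0.
have E z : (F \o vecn R n.+1) (reflect_car lam z) =
    F (refl lam (vecn R n.+1 z)) by rewrite /= vecn_reflect.
suff : {ae lebn R n.+1, forall z, A j 0%N z -> A j 0%N (reflect_car lam z) ->
    (F \o vecn R n.+1) z + (F \o vecn R n.+1) (reflect_car lam z) = 0}.
  by apply: filterS => z + Az Arz => /(_ Az Arz); rewrite E.
apply: (antisymmetric_limit_ae0 (measurable_reflect_car lam)
  (lebn_reflect lam) (fun k => measurable_dist_ge x (rad j k))
  _ _ _ _ _ _ _ Icvg L0).
- move=> k k' kk'; apply/subsetPset => z /=.
  move=> Az; apply: le_trans Az; exact: rad_le.
- move=> z; rewrite /A /= vecn_reflect; apply: dist_refl.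
  rewrite ler_piMr ?subr_ge0 ?(ltW xlam)//.
  by rewrite /harmonic/= invf_le1 ?ler1n ?ltr0n.
- by move: ae_neq; apply: filterS => z; exact: exists_A.
- move: ae_neq ae_neqr; apply: filterS2 => z; rewrite E; exact: F_le0.
- move=> k; have [ih _ _] := hP k; exact: ih.
- move=> k; have [_ hF _] := hP k; exact: hF.
- by move=> k; have [_ _ ] := hP k.
Qed.

Lemma fracp_antisymmetric_min : w x = 0 /\ leb_null [set y | w y <> 0].
Proof.
(* The equality case in [F_Sigma] gives both conclusions at once; [w x = 0] is carried along as a
   property of [z] and extracted later, the half-space being non-null. *)
have : {ae lebn R n.+1, forall z, (z.1 < lam -> w x = 0) /\
    w (vecn R n.+1 z) = 0}.
  move: (ae_foralln ae_sum0) ae_neq ae_neqr; apply: filterS3 => z S0 xz xrz.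
  have {}S0 : F (vecn R n.+1 z) + F (refl lam (vecn R n.+1 z)) = 0.
    have [k1 Ak1] := exists_A 0 xz.
    have xrz' : x 0 ord0 != vecn R n.+1 (reflect_car lam z) 0 ord0.
      by rewrite vecn_reflect.
    have [k2 Ak2] := exists_A 0 xrz'.
    (* Turns a truncation index at which both points are reached into a starting index [j] for
       [S0]. *)
    have radE k : rad 0 k = rad k 0 by rewrite /rad addn0.
    apply: (S0 (maxn k1 k2)).
      by apply: le_trans Ak1; rewrite -radE; apply: rad_le; exact: leq_maxl.
    by apply: le_trans Ak2; rewrite -radE; apply: rad_le; exact: leq_maxr.
  rewrite -vecnS_ord0; move: (vecn R n.+1 z) xz xrz S0 => y xy xry S0.
  have [yl|yl|yl] := ltgtP (y 0 ord0) lam.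
  - by have [_ /(_ S0)[]] := F_Sigma yl xy.
  - split=> //; have [_] := F_Sigma (Sigma_refl yl) xry.
    rewrite (reflK lam y) [F (refl lam y) + F y]addrC => /(_ S0)[_].
    by rewrite wN => /eqP; rewrite oppr_eq0 => /eqP.
  - by split=> //; rewrite /w /ulam refl_hyperplane ?subrr.
move=> [B [mB B0 sB]]; split.
  apply: contrapT => wx; have /eqP := B0; apply/negP.
  apply: (lebn_halfspace_not_null (a := lam) mB) => z zl; apply: sB => /=.
  by case=> /(_ zl).
exists B; split => // z wz; apply: sB => -[_]; exact: wz.
Qed.

End min_point.

(* Dimension of the space is n.+1 (i.e. any dimension >= 1). *)
Theorem theorem2p2 (R : realType) (n : nat) (s p lam C : R)
    (u : 'rV[R]_n.+1 -> R) (Om : set 'rV[R]_n.+1) :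
  0 < s < 1 -> 1 < p -> 0 < C ->
  let ulam := fun x => u (refl lam x) in
  let w := fun x => ulam x - u x in
  is_domain Om -> Om `<=` Sigma lam ->
  (bounded_set Om \/
   (forall e : R, 0 < e -> exists M : R,
      forall x, Om x -> M < eucl_norm x -> - e <= w x)) ->
  Lsp s p w -> C11_loc Om w -> lsc_on (closure Om) w ->
  (forall x, Om x -> exists L1 L2 : R,
     [/\ fracpL_at C s p ulam x L1, fracpL_at C s p u x L2 & 0 <= L1 - L2]) ->
  (forall x, Sigma lam x -> ~ Om x -> 0 <= w x) ->
  (forall x, Sigma lam x -> w (refl lam x) = - w x) ->
  (forall x, Om x -> 0 <= w x) /\
  ((exists x0, Om x0 /\ w x0 = 0) -> leb_null [set x | w x <> 0]).
Proof.
move=> s01 p1 C0 ulam w _ OmS far _ _ lscw fracw wout _.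
have min_eq0 x : Om x -> w x <= 0 -> (forall y, Sigma lam y -> w x <= w y) ->
    w x = 0 /\ leb_null [set y | w y <> 0].
  move=> Omx wx0 wmin; have [L1 [L2 [H1 H2 L12]]] := fracw _ Omx.
  exact: (fracp_antisymmetric_min s01 p1 C0 (OmS _ Omx) wx0 wmin H1 H2 L12).
have w_ge0 x : Om x -> 0 <= w x.
  move=> Omx; rewrite leNgt; apply/negP => wx0.
  (* Far away [w] cannot drop below [w x]: vacuously for bounded [Om], otherwise by the condition at
     infinity with [e = - w x]. *)
  have [M wM] : exists M : R, forall y, Om y -> M < `|y| -> w x <= w y.
    case: far => [[M [_ OmM]]|far].
      exists (M + 1) => y Omy; rewrite ltNge.
      by rewrite (OmM (M + 1) _ y Omy)// ltrDl.
    have nwx : 0 < - w x by rewrite oppr_gt0.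
    have [M wM] := far _ nwx; exists M => y Omy My.
    by have := wM y Omy (lt_le_trans My (le_norm_eucl_norm y)); rewrite opprK.
  (* The radius is at least [|x|] so that [x] lies in [K], making the minimum over [K] at most
     [w x]. *)
  pose K := closure Om `&`
    closed_ball_ (@Num.norm _ _) (0 : 'rV[R]_n.+1) (Num.max M `|x|).
  have cK : compact K.
    apply: bounded_closed_compact.
      exists (Num.max M `|x|); split; first exact: num_real.
      move=> r Mr y [_]; rewrite /closed_ball_ /= sub0r normrN => yM.
      exact: le_trans yM (ltW Mr).
    by apply: closedI; [exact: closed_closure|exact: closed_closed_ball_].
  have Kx : K x.
    split; first exact: subset_closure.
    by rewrite /closed_ball_ /= sub0r normrN le_max lexx orbT.
  have [|q [clq _] qmin] := lsc_compact_min (w := w) cK (ex_intro _ x Kx).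
    move=> y [cly _] e e0; have := lscw y cly e e0.
    by apply: filterS => z wz [clz _]; exact: wz.
  have wq0 : w q < 0 by apply: le_lt_trans wx0; exact: qmin.
  (* The minimiser [q] is so far only in [closure Om]. It is not on the hyperplane, where [w]
     vanishes, nor in [Sigma lam] outside [Om], where [w >= 0]; hence it lies in [Om]. *)
  have qlam : q 0 ord0 <= lam.
    have cl : closed [set y : 'rV[R]_n.+1 | y 0 ord0 <= lam].
      apply: (closed_comp (f := fun y : 'rV[R]_n.+1 => y 0 ord0) _
        (@closed_le _ lam)).
      by move=> y _; exact: coord_continuous.
    move/closure_id : cl => cl.
    have : closure [set y : 'rV[R]_n.+1 | y 0 ord0 <= lam] q.
      by apply: closureS clq => y /OmS/ltW.
    by rewrite -cl.
  have qS : Sigma lam q.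
    rewrite /Sigma /= lt_neqAle qlam andbT; apply/eqP => /refl_hyperplane rq.
    by move: wq0; rewrite /w /ulam rq subrr ltxx.
  have Omq : Om q.
    by apply: contrapT => nOmq; move: wq0; rewrite ltNge wout.
  have [wq _] : w q = 0 /\ leb_null [set y | w y <> 0].
    apply: min_eq0 => //; first exact: ltW.
    (* Minimality extends from [K] to [Sigma lam]: outside [Om] by the sign of [w], and in [Om]
       beyond the ball by comparison with [w x >= w q]. *)
    move=> y yS; have [Omy|nOmy] := pselect (Om y); last first.
      by rewrite (le_trans (ltW wq0))// wout.
    have [yM|My] := leP `|y| (Num.max M `|x|).
      apply: qmin; split; first exact: subset_closure.
      by rewrite /closed_ball_ /= sub0r normrN.
    apply: (le_trans (qmin x Kx)); apply: wM => //.
    by apply: le_lt_trans My; rewrite le_max lexx.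
  by rewrite wq ltxx in wq0.
split=> // -[x0 [Omx0 wx0]].
have [] // := min_eq0 x0 Omx0; first by rewrite wx0.
move=> y yS; rewrite wx0; have [Omy|nOmy] := pselect (Om y).
  exact: w_ge0.
exact: wout.
Qed.
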